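(* Let $1<\alpha<2$, let $N\ge 1$, and let $T_{\alpha,N}\in\mathbb R^{N\times N}$ be the lower Hessenberg Toeplitz matrix with entries $(T_{\alpha,N})_{ij}=-g^{(\alpha)}_{i-j+1}$ if $j\le i+1$ and $(T_{\alpha,N})_{ij}=0$ if $j>i+1$. Then, for every $\epsilon>0$, the $\epsilon$-qsrank of $T_{\alpha,N}$ is bounded by $$\mathrm{qsrank}_\epsilon(T_{\alpha,N})\le \mathfrak B\left(N,\frac{\epsilon}{2}\right)=2+2\left\lceil\frac{2}{\pi^2}\log\left(\frac4\pi N\right)\log\left(\frac{32}{\epsilon}\right)\right\rceil .$$
   Context: The alternating fractional binomial coefficients are $g_0^{(\alpha)}=1$ and $g_k^{(\alpha)}=(-1)^k\binom{\alpha}{k}=\frac{(-1)^k}{k!}\alpha(\alpha-1)\cdots(\alpha-k+1)$ for $k\ge1$. The notation $\mathfrak B(N,\epsilon)$ stands for $2+2\left\lceil\frac{2}{\pi^2}\log\left(\frac4\pi N\right)\log\left(\frac{16}{\epsilon}\right)\right\rceil$. $\log$ is the natural logarithm and $\|\cdot\|$ is the Euclidean (spectral) norm. For a square matrix $X$, $\mathrm{Off}(X)$ denotes the set of off-diagonal blocks of $X$, i.e. the submatrices entirely contained in the strictly lower or in the strictly upper triangular part of $X$, and $$\mathrm{qsrank}_\epsilon(X)=\max_{Y\in\mathrm{Off}(X)}\ \min_{\|\delta Y\|\le\epsilon\|X\|}\mathrm{rank}(Y+\delta Y)$$ (with value $0$ if $X$ has no off-diagonal blocks).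
   Formalization: The bound is stated as qsrank ≤ max(0, B(N, ε/2)), because for very large ε the printed B(N, ε/2) is negative (e.g. N = 1, ε = 32e^41 gives −2) while the qsrank is 0; whenever B(N, ε/2) ≥ 0 it is the printed inequality. *)

(* Defs.v *)
From mathcomp Require Import all_boot all_order all_algebra.
From mathcomp Require Import boolp classical_sets reals exp trigo.

Set Implicit Arguments.
Unset Strict Implicit.
Unset Printing Implicit Defensive.

Import Order.TTheory GRing.Theory Num.Theory.
Local Open Scope classical_set_scope.
Local Open Scope ring_scope.

Section Defs.
Variable R : realType.

Definition enorm (n : nat) (x : 'cV[R]_n) : R :=
  Num.sqrt (\sum_(i < n) x i 0 ^+ 2).

(* The unit ball, rather than the unit sphere, also covers n = 0. *)
Definition spectral_norm (m n : nat) (A : 'M[R]_(m, n)) : R :=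
  sup [set enorm (A *m x) | x in [set x : 'cV[R]_n | enorm x <= 1]].

(* min of \rank (Y + dY)%R over spectral_norm dY <= d. For 0 <= d, the rank of
   Y itself is attained at dY = 0, so only smaller ranks have to be tested;
   see min_rank_attained and min_rank_le. *)
Definition min_rank (m n : nat) (d : R) (Y : 'M[R]_(m, n)) : nat :=
  \big[Order.min / \rank Y]_(r < \rank Y |
    `[< exists dY : 'M[R]_(m, n),
          spectral_norm dY <= d /\ \rank (Y + dY)%R = r >]) (r : nat).

Definition submatrix (n : nat) (X : 'M[R]_n) (I J : {set 'I_n}) :
    'M[R]_(#|I|, #|J|) :=
  mxsub (@enum_val _ (mem I)) (@enum_val _ (mem J)) X.

(* The rows I and columns J select a nonempty submatrix inside the strictly
   lower, or inside the strictly upper, triangular part. *)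
Definition off_diagonal (n : nat) (I J : {set 'I_n}) : bool :=
  [&& (0 < #|I|)%N, (0 < #|J|)%N &
      [forall i in I, forall j in J, (j < i)%N]
      || [forall i in I, forall j in J, (i < j)%N]].

Definition qsrank (n : nat) (eps : R) (X : 'M[R]_n) : nat :=
  \max_(IJ : {set 'I_n} * {set 'I_n} | off_diagonal IJ.1 IJ.2)
    min_rank (eps * spectral_norm X) (submatrix X IJ.1 IJ.2).

Definition gbinom (a : R) (k : nat) : R :=
  (-1) ^+ k / k`!%:R * \prod_(0 <= i < k) (a - i%:R).

(* The indices start at 0, which leaves i - j + 1 unchanged. *)
Definition Tmx (a : R) (n : nat) : 'M[R]_n :=
  \matrix_(i, j) (if (j <= i.+1)%N then - gbinom a (i.+1 - j) else 0).

(* An integer, negative when eps is very large. *)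
Definition Bfrak (n : nat) (eps : R) : int :=
  2 + 2 * Num.ceil (2 / pi ^+ 2 * ln (4 / pi * n%:R) * ln (16 / eps) : R).

Lemma spectral_norm0 (m n : nat) : spectral_norm (0 : 'M[R]_(m, n)) = 0.
Proof.
have E0 p : enorm (0 : 'cV[R]_p) = 0.
  rewrite /enorm big1 ?sqrtr0 // => i _; by rewrite mxE expr0n.
rewrite /spectral_norm (_ : [set _ | _ in _] = [set 0]) ?sup1 //.
apply/seteqP; split => y /=.
  by case=> x _ <-; rewrite mul0mx E0.
by move=> ->; exists 0; rewrite ?mul0mx ?E0 ?ler01.
Qed.

Lemma min_rank_attained (m n : nat) (d : R) (Y : 'M[R]_(m, n)) : 0 <= d ->
  exists dY : 'M[R]_(m, n),
    spectral_norm dY <= d /\ \rank (Y + dY)%R = min_rank d Y.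
Proof.
move=> d0; rewrite /min_rank.
apply: (big_ind (fun r => exists dY : 'M[R]_(m, n),
    spectral_norm dY <= d /\ \rank (Y + dY)%R = r)) => [|x y hx hy|r /asboolP//].
  by exists 0; rewrite spectral_norm0 addr0.
by rewrite /Order.min; case: ifP.
Qed.

Lemma min_rank_le (m n : nat) (d : R) (Y dY : 'M[R]_(m, n)) :
  spectral_norm dY <= d -> (min_rank d Y <= \rank (Y + dY)%R)%N.
Proof.
move=> hd; rewrite /min_rank.
have [lt|ge] := ltnP (\rank (Y + dY)%R) (\rank Y).
  rewrite -leEnat; apply: (bigmin_inf (Ordinal lt)) => //.
  by apply/asboolP; exists dY.
by apply: leq_trans ge; rewrite -leEnat; exact: bigmin_le_id.
Qed.

End Defs.

(* Main.v *)
(** Below the diagonal the entries of the matrix are [- g (a + b + 2)], where [a]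
    and [b] are the distances of the row and of the column to the corner of the
    largest block. The recurrence [(k + 1) g (k + 1) = (k - alpha) g k] gives, up
    to a factor at most [3 / 8], the partial fractions
      [g k = \sum_m g m / (k - alpha + m)],
    hence with [x = a + 1] and [y_m = b + 1 - alpha + m] a sum of Cauchy kernels
    [1 / (x + y_m)]. For [B x = \prod_l (x - xi_l) / (x + xi_l)] with [L] positive
    nodes, [(1 - B x * B y) / (x + y)] is separable with [L] terms, and what is
    left is at most [`|B x| / (x + y)]. As the sum of the [`|g m|] is at most
    [2 * alpha], the error is bounded by a Hilbert matrix, whose norm does not
    grow with [N]; the row [a = 0] and the column [b = 0] are kept exactly, which
    costs the additional rank 2. By symmetry [x] may be taken to be the shorter of
    the two sides, so that [2 <= x <= N / 2], and nodes in geometric progression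
    make [B] as small as needed there. Above the diagonal there is only one
    nonzero entry in each block, and for [eps >= 1] every block may be removed
    altogether. *)

Require Import Defs.
From mathcomp Require Import all_boot all_order all_algebra.
From mathcomp Require Import boolp classical_sets reals topology normedtype sequences derive exp trigo.
From mathcomp Require Import ring lra zify.
Import Order.TTheory GRing.Theory Num.Theory.
Import numFieldNormedType.Exports.
Local Open Scope classical_set_scope.
Local Open Scope ring_scope.

(** * Elementary bounds for sine, cosine, [pi] and the exponential *)

Lemma le_of_deriv_ge0 (R : realType) (f df : R -> R) (x : R) :
  0 <= x -> (forall y, is_derive y (1 : R) f (df y)) ->
  (forall y, 0 <= y <= x -> 0 <= df y) -> f 0 <= f x.
Proof.
move=> x0 fdf df0; rewrite -subr_ge0.
have cf : {within `[0, x], continuous f}.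
  by apply: derivable_within_continuous => y _; exact: ex_derive.
have [c cI ->] := MVT_segment x0 (fun y _ => fdf y) cf.
by rewrite subr0 mulr_ge0// df0; move: cI; rewrite in_itv.
Qed.

Lemma sin_le_id (R : realType) (x : R) : 0 <= x -> sin x <= x.
Proof.
move=> x0.
have := @le_of_deriv_ge0 R (fun y => y - sin y) (fun y => 1 - cos y) x x0.
rewrite sin0 subrr subr_ge0; by apply => y _; rewrite subr_ge0 cos_le1.
Qed.

Lemma cos_ge_taylor2 (R : realType) (x : R) : 0 <= x -> 1 - x ^+ 2 / 2 <= cos x.
Proof.
move=> x0.
have := @le_of_deriv_ge0 R (fun y => cos y + y * y * 2^-1)
  (fun y => - sin y + y) x x0.
rewrite cos0 !mul0r addr0 => H; rewrite expr2 lerBlDr; apply: H => y.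
  apply: is_derive_eq; rewrite /GRing.scale /=; lra.
by case/andP=> y0 _; rewrite addrC subr_ge0 sin_le_id.
Qed.

Lemma sin_ge_taylor3 (R : realType) (x : R) : 0 <= x -> x - x ^+ 3 / 6 <= sin x.
Proof.
move=> x0.
have := @le_of_deriv_ge0 R (fun y => sin y - y + y * y * y * 6^-1)
  (fun y => cos y - 1 + y ^+ 2 / 2) x x0.
rewrite sin0 !mul0r subrr addr0 => H.
suff : 0 <= sin x - x + x * x * x * 6^-1 by lra.
apply: H => y.
  apply: is_derive_eq; rewrite /GRing.scale /=; lra.
by case/andP=> y0 _; have := cos_ge_taylor2 _ _ y0; lra.
Qed.

Lemma cos_le_taylor4 (R : realType) (x : R) :
  0 <= x -> cos x <= 1 - x ^+ 2 / 2 + x ^+ 4 / 24.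
Proof.
move=> x0.
have := @le_of_deriv_ge0 R
  (fun y => - cos y - y * y * 2^-1 + y * y * y * y * 24^-1)
  (fun y => sin y - y + y ^+ 3 / 6) x x0.
rewrite cos0 !mul0r subr0 addr0 => H.
suff : - 1 <= - cos x - x * x * 2^-1 + x * x * x * x * 24^-1 by lra.
apply: H => y.
  apply: is_derive_eq; rewrite /GRing.scale /=; lra.
by case/andP=> y0 _; have := sin_ge_taylor3 _ _ y0; lra.
Qed.

(** Otherwise [8 / 5] would lie below [pi / 2], where the cosine is positive, although the Taylor
    bound of degree 4 is negative at [8 / 5]. *)
Lemma pi_le_16_5 (R : realType) : pi <= 16 / 5 :> R.
Proof.
have [//|lt] := leP (pi : R) (16 / 5).
have : 0 < cos (8 / 5 : R) by apply: cos_gt0_pihalf; apply/andP; split; lra.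
by have := @cos_le_taylor4 R (8 / 5); rewrite ltNge; lra.
Qed.

(** For [q < 1] this is [q <= artanh q]. After division by [expR q] the difference of the two sides
    has the derivative [2 * y * sinh y]. *)
Lemma expR_artanh (R : realType) (q : R) :
  0 <= q -> expR (2 * q) * (1 - q) <= 1 + q.
Proof.
move=> q0.
have := @le_of_deriv_ge0 R
  (fun y => (1 + y) * expR (- y) - (1 - y) * expR y)
  (fun y => y * (expR y - expR (- y))) q q0.
rewrite oppr0 expR0 addr0 subrr => H.
have {}H : 0 <= (1 + q) * expR (- q) - (1 - q) * expR q.
  apply: H => y.
    apply: is_derive_eq; rewrite /GRing.scale /=; lra.
  case/andP=> y0 _; rewrite mulr_ge0// subr_ge0 ler_expR; lra.
rewrite -(ler_pM2r (expR_gt0 (- q))).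
rewrite -subr_ge0; apply: (le_trans H).
rewrite -subr_ge0 (_ : _ - _ = 0) ?lexx//.
have -> : 2 * q = q + q by lra.
rewrite expRD expRN; have := expR_eq0 q => /negbT q_; by field.
Qed.

(** * Signs and sums of the fractional binomial coefficients *)

Lemma gbinom0 (R : realType) (a : R) : gbinom a 0 = 1.
Proof. by rewrite /gbinom big_nil fact0 expr0 divr1 mulr1. Qed.

Lemma gbinomS (R : realType) (a : R) (k : nat) :
  k.+1%:R * gbinom a k.+1 = (k%:R - a) * gbinom a k.
Proof.
rewrite /gbinom big_nat_recr//= factS natrM exprS.
have k1 : k.+1%:R != 0 :> R by rewrite pnatr_eq0.
have kf : k`!%:R != 0 :> R by rewrite pnatr_eq0 -lt0n fact_gt0.
by field; rewrite kf addrC natr1.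
Qed.

Lemma gbinom1 (R : realType) (a : R) : gbinom a 1 = - a.
Proof. by have := gbinomS R a 0; rewrite gbinom0; lra. Qed.

Lemma gbinom2 (R : realType) (a : R) : gbinom a 2 = a * (a - 1) / 2.
Proof. by have := gbinomS R a 1; rewrite gbinom1; lra. Qed.

Lemma gbinom_ge0 (R : realType) (a : R) (k : nat) :
  1 < a -> a < 2 -> (2 <= k)%N -> 0 <= gbinom a k.
Proof.
move=> a1 a2; elim: k => // k IH; rewrite leq_eqVlt => /orP[/eqP<-|k2].
  by rewrite gbinom2; nra.
have k2R : 2 <= k%:R :> R by rewrite (ler_nat _ 2).
rewrite -(pmulr_rge0 _ (ltr0Sn R k)) gbinomS mulr_ge0 ?IH//; lra.
Qed.

Lemma sum_gbinom (R : realType) (a : R) (n : nat) :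
  a * \sum_(0 <= k < n) gbinom a k = - (n%:R * gbinom a n).
Proof.
elim: n => [|n IH]; first by rewrite big_nil mulr0 mul0r oppr0.
rewrite big_nat_recr//= mulrDr IH gbinomS; lra.
Qed.

(** Only [gbinom a 1 = - a] is negative, so absolute values add [2 * a] to the plain sum, which is
    nonpositive from two terms on by [sum_gbinom]. *)
Lemma sum_norm_gbinom (R : realType) (a : R) (n : nat) :
  1 < a -> a < 2 -> \sum_(0 <= k < n) `|gbinom a k| <= 2 * a.
Proof.
move=> a1 a2.
have H m : \sum_(0 <= k < m.+2) `|gbinom a k|
    = \sum_(0 <= k < m.+2) gbinom a k + 2 * a.
  elim: m => [|m IH].
    rewrite !big_nat_recr//= !big_nil !gbinom0 !gbinom1 normr1 normrN gtr0_norm; lra.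
  rewrite big_nat_recr//= IH [in RHS]big_nat_recr//= ger0_norm ?gbinom_ge0//; lra.
suff [m nm] : exists m, (n <= m.+2)%N.
  apply: (@le_trans _ _ (\sum_(0 <= k < m.+2) `|gbinom a k|)).
    by rewrite (big_cat_nat _ nm)//= lerDl sumr_ge0.
  rewrite H gerDr -(pmulr_rle0 _ (_ : 0 < a)) ?sum_gbinom; last lra.
  by rewrite oppr_le0 mulr_ge0// gbinom_ge0.
by exists n; lia.
Qed.

(** * Partial fractions of the coefficients *)

Lemma mul_gbinom_le2 (R : realType) (a : R) (n : nat) :
  1 < a -> a < 2 -> (2 <= n)%N -> n%:R * gbinom a n <= 2.
Proof.
move=> a1 a2 n2; have := sum_gbinom R a n.
suff : 1 - a <= \sum_(0 <= k < n) gbinom a k by nra.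
rewrite (big_cat_nat _ n2)//= !big_nat_recr//= big_nil gbinom0 gbinom1 add0r.
by rewrite lerDl big_nat sumr_ge0// => i /andP[i2 _]; rewrite gbinom_ge0.
Qed.

(* The partial fraction expansion of [k |-> gbinom a k], whose poles are the
   numbers [a - m], truncated and up to a constant factor. *)
Definition pfrac (R : realType) (a : R) (n k : nat) : R :=
  \sum_(0 <= m < n) gbinom a m / (k%:R - a + m%:R).

(** The truncated expansion obeys the recurrence [gbinomS] up to a remainder that comes from the cut
    at [n]. *)
Lemma pfracS (R : realType) (a : R) (n k : nat) : a < 2 -> (2 <= k)%N ->
  k.+1%:R * pfrac R a n k.+1 =
  (k%:R - a) * pfrac R a n k - n%:R * gbinom a n / (k%:R - a + n%:R).
Proof.
move=> a2 k2; have k2R : 2 <= k%:R :> R by rewrite (ler_nat _ 2).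
elim: n => [|n IH]; first by rewrite /pfrac !big_nil; lra.
move: IH; rewrite /pfrac !big_nat_recr//= gbinomS 2!mulrDr => ->.
have n0 : 0 <= n%:R :> R by [].
by rewrite -!natr1; field; lra.
Qed.

Lemma pfrac2_ge (R : realType) (a : R) (n : nat) : 1 < a -> a < 2 -> (2 <= n)%N ->
  (2 - a)^-1 - a / (3 - a) <= pfrac R a n 2.
Proof.
move=> a1 a2 n2; rewrite /pfrac (big_cat_nat _ n2)//= !big_nat_recr//= big_nil.
rewrite gbinom0 gbinom1.
have -> : 0 + 1 / (2 - a + 0) + - a / (2 - a + 1) = (2 - a)^-1 - a / (3 - a).
  by field; lra.
rewrite lerDl big_nat sumr_ge0// => i /andP[i2 _].
by rewrite divr_ge0 ?gbinom_ge0//; have : 0 <= i%:R :> R by []; lra.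
Qed.

(** The factor [c] makes both sides agree at [k = 2]. The common recurrence damps the error from [k]
    to [k + 1] enough to absorb the remainder of [pfracS]. *)
Lemma gbinom_pfrac (R : realType) (a : R) (n : nat) :
  1 < a -> a < 2 -> (2 <= n)%N ->
  exists2 c : R, 0 <= c <= 3 / 8 &
    forall k, (2 <= k)%N -> `|gbinom a k - c * pfrac R a n k| <= n%:R^-1.
Proof.
move=> a1 a2 n2.
have dE : (2 - a)^-1 - a / (3 - a)
    = (3 - 3 * a + a ^+ 2) / ((2 - a) * (3 - a)) by field; lra.
have p0 : 0 < (2 - a)^-1 - a / (3 - a).
  rewrite dE.
  by rewrite divr_gt0//; nra.
have pn := pfrac2_ge R a n a1 a2 n2.
have pn0 := lt_le_trans p0 pn.
(* The quotient of [gbinom a 2] by the lower bound of [pfrac2_ge] is largest at [a = 3 / 2], where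
   it equals [3 / 8]. *)
have cle : 0 <= gbinom a 2 / pfrac R a n 2 <= 3 / 8.
  rewrite divr_ge0 ?gbinom_ge0 ?(ltW pn0)//= ler_pdivrMr//.
  apply: (@le_trans _ _ (3 / 8 * ((2 - a)^-1 - a / (3 - a)))); last by rewrite ler_pM2l//; lra.
  rewrite gbinom2 dE.
  rewrite mulrA ler_pdivlMr; last by nra.
  have : 0 <= (a - 3 / 2) ^+ 2 by rewrite sqr_ge0.
  have : 0 < (a - 1) * (2 - a) by nra.
  nra.
exists (gbinom a 2 / pfrac R a n 2) => //; set c := gbinom a 2 / _ in cle *.
have n0 : 2 <= n%:R :> R by rewrite (ler_nat _ 2).
elim=> // k IH; rewrite leq_eqVlt => /orP[/eqP<-|k2].
  by rewrite /c divfK ?gt_eqF// subrr normr0 invr_ge0; lra.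
have k2R : 2 <= k%:R :> R by rewrite (ler_nat _ 2).
have {IH} := IH k2; set e := gbinom a k - _ => IH.
have k1 : 0 < k.+1%:R :> R by [].
rewrite -(ler_pM2l k1) -[k.+1%:R in X in X <= _]gtr0_norm// -normrM mulrBr gbinomS.
rewrite (mulrCA _ c) pfracS//.
set t := n%:R * gbinom a n / _.
have ng0 : 0 <= n%:R * gbinom a n by rewrite mulr_ge0// gbinom_ge0.
have t0 : 0 <= t by rewrite divr_ge0//; lra.
have tle : c * t <= n%:R^-1.
  have -> : n%:R^-1 = 2^-1 * (2 / n%:R) :> R by field; lra.
  rewrite ler_pM//; [lra|lra|].
  rewrite ler_pM ?mul_gbinom_le2 ?invr_ge0//; first lra.
  by rewrite lef_pV2 ?posrE; lra.
have -> : (k%:R - a) * gbinom a k - c * ((k%:R - a) * pfrac R a n k - t)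
    = (k%:R - a) * e + c * t by rewrite /e; lra.
apply: (le_trans (ler_normD _ _)).
rewrite normrM (ger0_norm (_ : 0 <= k%:R - a)); last lra.
rewrite (ger0_norm (_ : 0 <= c * t)); last by rewrite mulr_ge0//; lra.
rewrite -natr1; have : 0 < n%:R^-1 :> R by rewrite invr_gt0; lra.
nra.
Qed.

(** * Blaschke products of the right half-plane with real zeros *)

Definition blaschke (R : realType) (xi : nat -> R) (n : nat) (x : R) : R :=
  \prod_(0 <= l < n) ((x - xi l) / (x + xi l)).

Lemma norm_blaschke_le1 (R : realType) (xi : nat -> R) (n : nat) (x : R) :
  (forall l, 0 < xi l) -> 0 < x -> `|blaschke R xi n x| <= 1.
Proof.
move=> xi0 x0; rewrite /blaschke normr_prod; apply: prodr_ile1 => l _.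
rewrite normr_ge0 normrM normfV (gtr0_norm (addr_gt0 x0 (xi0 l))).
rewrite ler_pdivrMr ?addr_gt0// mul1r ler_norml; have := xi0 l; lra.
Qed.

(** A new node multiplies the old kernel by [rho x * rho y] and adds
    [(1 - rho x * rho y) / (x + y)], which is the single product
    [2 * xi n / ((x + xi n) * (y + xi n))]. *)
Lemma blaschke_separable (R : realType) (xi : nat -> R) (n : nat) :
  (forall l, 0 < xi l) ->
  exists phi psi : nat -> R -> R, forall x y, 0 < x -> 0 < y ->
    (1 - blaschke R xi n x * blaschke R xi n y) / (x + y) =
    \sum_(0 <= l < n) phi l x * psi l y.
Proof.
move=> xi0; elim: n => [|n [phi [psi IH]]].
  exists (fun _ _ => 0), (fun _ _ => 0) => x y _ _.
  by rewrite /blaschke !big_nil mulr1 subrr mul0r.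
pose rho x := (x - xi n) / (x + xi n).
exists (fun l x => if l == n then 2 * xi n / (x + xi n) else rho x * phi l x),
       (fun l y => if l == n then (y + xi n)^-1 else rho y * psi l y).
move=> x y x0 y0; rewrite big_nat_recr//= eqxx.
rewrite (eq_big_nat _ _ (F2 := fun l => rho x * rho y * (phi l x * psi l y))).
  rewrite -mulr_sumr -IH// /blaschke !big_nat_recr//= /rho.
  by field; have := xi0 n; lra.
by move=> l /andP[_ ln]; rewrite ltn_eqF//; lra.
Qed.

(** The modulus is [(1 - q) / (1 + q) = expR (- 2 * artanh q)]. *)
Lemma blaschke_factor_le (R : realType) (x xi q : R) : 0 < x -> 0 < xi ->
  q <= 1 -> q = x / xi \/ q = xi / x ->
  `|(x - xi) / (x + xi)| <= expR (- (2 * q)).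
Proof.
move=> x0 xi0 q1 qE.
have q0 : 0 < q by case: qE => ->; rewrite divr_gt0.
rewrite normrM normfV (gtr0_norm (addr_gt0 x0 xi0)) ler_pdivrMr ?addr_gt0//.
rewrite -(ler_pM2r (expR_gt0 (2 * q))) mulrAC -expRD addNr expR0 mul1r.
have := expR_artanh R q (ltW q0); have E0 := expR_gt0 (2 * q).
case: qE => qE.
  have -> : x = q * xi by rewrite qE divfK// gt_eqF.
  rewrite ler0_norm; first by nra.
  by rewrite subr_le0 ler_piMl// ltW.
have -> : xi = q * x by rewrite qE divfK// gt_eqF.
rewrite ger0_norm; first by nra.
by rewrite subr_ge0 ler_piMl// ltW.
Qed.

(* [potential x C] is the integral over [-oo < v < ln C] of
   [expR (- `|ln x - v|)], so that its increments over the cells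
   [C, C * t ^ 2] sum up to nearly 2. *)
Definition potential (R : realType) (x C : R) : R :=
  if C <= x then C / x else 2 - x / C.

(** The node is the logarithmic midpoint of the cell. If [x] is outside the cell, the increment is
    exactly [q * (t - t^-1)], with [q] the ratio in [blaschke_factor_le]. If [x] is inside, it is at
    most that, by [2 <= z + z^-1]. *)
Lemma blaschke_factor_potential (R : realType) (x C t : R) :
  0 < x -> 0 < C -> 1 < t ->
  `|(x - C * t) / (x + C * t)| <=
  expR (- (2 * ((potential R x (C * t ^+ 2) - potential R x C) / (t - t^-1)))).
Proof.
move=> x0 C0 t1.
have t0 : 0 < t by lra.
have d0 : 0 < t - t^-1.
  by rewrite subr_gt0 (le_lt_trans _ t1)// invf_le1// ltW.
have Ct0 : 0 < C * t by rewrite mulr_gt0.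
have AG (z : R) : 0 < z -> 2 <= z + z^-1.
  move=> z0; rewrite -subr_ge0.
  rewrite (_ : _ - _ = (z - 1) ^+ 2 / z); last by field; rewrite gt_eqF.
  by rewrite divr_ge0 ?sqr_ge0 ?ltW.
have Cle : C <= C * t by nra.
have Cle2 : C * t <= C * t ^+ 2 by nra.
have [tx|xt] := leP (C * t) x.
  pose q := C * t / x.
  apply: (le_trans (blaschke_factor_le R x (C * t) q x0 Ct0 _ _)).
  - by rewrite ler_pdivrMr// mul1r.
  - by right.
  rewrite ler_expR lerN2 ler_pM2l// ler_pdivrMr// /potential (le_trans Cle tx).
  have -> : q * (t - t^-1) = C * t ^+ 2 / x - C / x.
    by rewrite /q; field; rewrite !gt_eqF.
  case: ifP => // _; rewrite lerD2r lerBlDl.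
  have -> : x / (C * t ^+ 2) = (C * t ^+ 2 / x)^-1 by rewrite invf_div.
  by rewrite addrC AG// divr_gt0// mulr_gt0// exprn_gt0.
pose q := x / (C * t).
apply: (le_trans (blaschke_factor_le R x (C * t) q x0 Ct0 _ _)).
- by rewrite ler_pdivrMr// mul1r ltW.
- by left.
rewrite ler_expR lerN2 ler_pM2l// ler_pdivrMr// /potential.
rewrite (lt_geF (lt_le_trans xt Cle2)).
have -> : q * (t - t^-1) = x / C - x / (C * t ^+ 2).
  by rewrite /q; field; rewrite !gt_eqF.
case: ifP => _; last by lra.
have := AG (x / C) (divr_gt0 x0 C0); rewrite invf_div; lra.
Qed.

Lemma norm_blaschke_le (R : realType) (x C t : R) (n : nat) :
  0 < x -> 0 < C -> 1 < t -> C <= x -> x <= C * t ^+ (2 * n) ->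
  `|blaschke R (fun l => C * t ^+ (2 * l).+1) n x| <=
  expR (- (2 * ((2 - x / (C * t ^+ (2 * n)) - C / x) / (t - t^-1)))).
Proof.
move=> x0 C0 t1 Cx xC; have t0 : 0 < t by lra.
apply: (@le_trans _ _ (expR (- (2 *
    ((potential R x (C * t ^+ (2 * n)) - potential R x C) / (t - t^-1)))))).
  rewrite /blaschke; elim: (n) => [|m IH].
    by rewrite big_nil muln0 mulr1 subrr mul0r mulr0 oppr0 expR0 normr1.
  rewrite big_nat_recr//= normrM.
  have Cm : 0 < C * t ^+ (2 * m) by rewrite mulr_gt0// exprn_gt0.
  have := blaschke_factor_potential R x (C * t ^+ (2 * m)) t x0 Cm t1.
  rewrite -!mulrA -exprSr -exprD -(_ : 2 * m.+1 = 2 * m + 2)%N; last by lia.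
  move=> H; apply: (le_trans (ler_pM _ _ IH H)) => //.
  by rewrite -expRD ler_expR; lra.
rewrite ler_expR lerN2 ler_pM2l// ler_pM2r; last first.
  by rewrite invr_gt0 subr_gt0 (le_lt_trans _ t1)// invf_le1// ltW.
(* The two branches of [potential] agree at the right end point, where both give 1. *)
rewrite /potential Cx; case: ifP => // h.
have -> : C * t ^+ (2 * n) = x by apply/eqP; rewrite eq_le h xC.
rewrite divff ?gt_eqF//; lra.
Qed.

Lemma expR3_le (R : realType) : expR 3 <= 32 :> R.
Proof.
have := expR_artanh R (1 / 4); rewrite (_ : 2 * (1 / 4) = 1 / 2); last lra.
set e := expR (1 / 2) => H; have e0 : 0 < e := expR_gt0 _.
have -> : 3 = 1 / 2 *+ 6 :> R by lra.
rewrite -[_ *+ _]mulr_natl expRM_natl -/e (_ : 6 = 3 * 2)%N // exprM.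
have e2 : e <= 5 / 3 by lra.
have : e ^+ 3 <= (5 / 3) ^+ 3 by rewrite lerXn2r ?nnegrE//; lra.
have : 0 <= e ^+ 3 by rewrite exprn_ge0// ltW.
nra.
Qed.

(** From [expR z <= (2 + z) / (2 - z)]; it bounds [t - t^-1] by nearly [2 * z] for the ratio
    [t = expR z]. *)
Lemma expR_sinh_le (R : realType) (z : R) : 0 <= z -> z < 2 ->
  (expR z - (expR z)^-1) * (4 - z ^+ 2) <= 8 * z.
Proof.
move=> z0 z2; have := expR_artanh R (z / 2); rewrite (_ : 2 * (z / 2) = z); last lra.
set e := expR z => H; have e0 : 0 < e := expR_gt0 _.
have {}H : e * (2 - z) <= 2 + z by lra.
have H' : 2 - z <= e^-1 * (2 + z) by rewrite mulrC ler_pdivlMr// mulrC.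
nra.
Qed.

(* The nodes are in geometric progression in [[9/10, 18 N / (5 pi)]], which
   exceeds [[2, N/2]] by enough at both ends for the bound of
   [norm_blaschke_le], and whose ratio of end points is [4 N / pi]. *)
Lemma exists_blaschke_nodes (R : realType) (N L : nat) (eps : R) :
  (10 <= N)%N -> 0 < eps -> eps < 1 ->
  2 * (2 / pi ^+ 2 * ln (4 / pi * N%:R) * ln (32 / eps)) <= L%:R ->
  exists2 xi : nat -> R, (forall l, 0 < xi l) &
    forall x, 2 <= x -> 2 * x <= N%:R -> `|blaschke R xi L x| <= eps / 32.
Proof.
move=> N10 eps0 eps1.
have NR : 10 <= N%:R :> R by rewrite (ler_nat _ 10).
have p2 := pi_ge2 R; have p16 := pi_le_16_5 R.
set w := 4 / pi * N%:R; set lw := ln w; set le := ln (32 / eps).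
have wE : w * pi = 4 * N%:R by rewrite /w mulrAC divfK//; lra.
have w1 : 1 < w by nra.
have lw0 : 0 < lw by rewrite ln_gt0.
have le3 : 3 <= le.
  rewrite -(expRK 3) ler_ln ?posrE ?expR_gt0 ?divr_gt0//.
  rewrite (le_trans (expR3_le R))// ler_pdivlMr//; lra.
have pp0 : 0 < pi ^+ 2 :> R by rewrite exprn_gt0//; lra.
have pp : pi ^+ 2 <= 256 / 25 :> R by nra.
rewrite !mulrA -mulrA mulrAC ler_pdivrMr// => HL.
have L0 : 0 < L%:R :> R.
  have : 0 < lw * le by rewrite mulr_gt0//; lra.
  nra.
(* With this choice [t ^+ (2 * L) = w], and the hypothesis on [L] gives [z * le <= pi ^+ 2 / 8]. *)
pose z := lw / (2 * L%:R).
have z0 : 0 < z by rewrite divr_gt0//; lra.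
have zle : z * le <= 32 / 25.
  rewrite /z mulrAC ler_pdivrMr; last lra.
  nra.
have z1 : z <= 32 / 75 by nra.
pose t := expR z.
have t1 : 1 < t by rewrite expR_gt1.
have tL : t ^+ (2 * L) = w.
  rewrite -expRM_natl natrM /z mulrC divfK; last lra.
  by rewrite lnK// posrE; lra.
exists (fun l => 9 / 10 * t ^+ (2 * l).+1) => [l|x x2 xN].
  by rewrite mulr_gt0 ?exprn_gt0//; lra.
have wx : 2 * x * pi <= 4 * w / 1 by nra.
apply: (le_trans (norm_blaschke_le R x (9 / 10) t L _ _ t1 _ _)); try lra.
  rewrite tL; nra.
rewrite tL.
(* The two end losses are largest at [x = 2] or [x = N / 2]. For [N = 10] their bounds there are
   about 0.628 and 0.624; the offset [9 / 10] balances them. *)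
have fx : x / (9 / 10 * w) + 9 / 10 / x <= 63 / 100.
  have -> : x / (9 / 10 * w) = x * pi / (18 / 5 * N%:R).
    rewrite -[pi](@mulfK _ w) ?gt_eqF//; last lra.
    rewrite (mulrC pi) wE; field; lra.
  have h1 : x * pi / (18 / 5 * N%:R) <= 8 / 9 * x / N%:R.
    rewrite ler_pdivrMr; last lra.
    rewrite (_ : 8 / 9 * x / N%:R * (18 / 5 * N%:R) = x * (16 / 5)); last by field; lra.
    by rewrite ler_pM2l//; lra.
  apply: (le_trans (lerD h1 (lexx _))).
  rewrite (_ : 8 / 9 * x / N%:R + 9 / 10 / x =
    (8 / 9 * x ^+ 2 + 9 / 10 * N%:R) / (x * N%:R)); last by field; lra.
  rewrite ler_pdivrMr; last by rewrite mulr_gt0//; lra.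
  have := mulr_ge0 (_ : 0 <= x - 2) (_ : 0 <= N%:R - 2 * x).
  have := mulr_ge0 (_ : 0 <= x - 2) (_ : 0 <= N%:R - 10).
  nra.
have d0 : 0 < t - t^-1.
  by rewrite subr_gt0 (le_lt_trans _ t1)// invf_le1 ?(ltW t1)//; lra.
rewrite -[eps / 32]invf_div -[32 / eps]lnK ?posrE ?divr_gt0// -/le -(expRN le).
rewrite ler_expR lerN2 mulrA ler_pdivlMr//.
(* [137 / 50] is [2 * (2 - 63 / 100)], while the left side is at most [8 * (32 / 25) / (19 / 5)],
   about 2.695. *)
apply: (@le_trans _ _ (137 / 50)); last lra.
have := expR_sinh_le R z (ltW z0); rewrite -/t.
have z2 : z < 2 by lra.
move=> /(_ z2) H.
have : (t - t^-1) * (4 - z ^+ 2) * le <= 8 * z * le by rewrite ler_wpM2r//; lra.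
have : 19 / 5 <= 4 - z ^+ 2 by nra.
have : 0 <= le * (t - t^-1) by rewrite mulr_ge0//; lra.
nra.
Qed.

(** * Spectral norms and Hilbert's inequality *)

Lemma weighted_cauchy_schwarz (R : realType) (n : nat) (p u : 'I_n -> R) :
  (forall i, 0 <= p i) ->
  (\sum_i p i * u i) ^+ 2 <= (\sum_i p i) * \sum_i p i * u i ^+ 2.
Proof.
move=> p0.
(* Lagrange's identity: this double sum is twice the difference of the two sides. *)
have : 0 <= \sum_i \sum_j p i * p j * (u i - u j) ^+ 2.
  by apply: sumr_ge0 => i _; apply: sumr_ge0 => j _; rewrite mulr_ge0 ?sqr_ge0 ?mulr_ge0.
have -> : \sum_i \sum_j p i * p j * (u i - u j) ^+ 2 =
    2 * ((\sum_i p i) * (\sum_i p i * u i ^+ 2) - (\sum_i p i * u i) ^+ 2).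
  have E (f g : 'I_n -> R) :
      \sum_i \sum_j f i * g j = (\sum_i f i) * (\sum_j g j).
    by rewrite mulr_suml; apply: eq_bigr => i _; rewrite mulr_sumr.
  transitivity (\sum_i \sum_j (p i * u i ^+ 2) * p j
      + \sum_i \sum_j p i * (p j * u j ^+ 2)
      + \sum_i \sum_j (- 2 * (p i * u i)) * (p j * u j)).
    rewrite -!big_split; apply: eq_bigr => i _.
    by rewrite -!big_split; apply: eq_bigr => j _ /=; ring.
  by rewrite !E -mulr_sumr; ring.
by rewrite pmulr_rge0// subr_ge0.
Qed.

Lemma sum_inj_le (R : realType) (n B : nat) (b : 'I_n -> nat) (F : nat -> R) :
  injective b -> (forall j, (b j < B)%N) -> (forall k, 0 <= F k) ->
  \sum_j F (b j) <= \sum_(0 <= k < B) F k.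
Proof.
move=> b_inj bB F0; pose b' j := Ordinal (bB j).
have b'_inj : injective b' by move=> i j [] /b_inj.
rewrite big_mkord (bigID (mem (b' @: 'I_n)))/=.
rewrite big_imset/=; last by move=> i j _ _ /b'_inj.
by rewrite -[leLHS]addr0 lerD ?sumr_ge0.
Qed.

(* The increments of [k |-> - 4 / (sqrt a + sqrt k)] dominate the summands. *)
Lemma hilbert_sum_le (R : realType) (a B : nat) : (0 < a)%N ->
  \sum_(0 <= k < B.+1) ((a + k)%:R * Num.sqrt k%:R)^-1 <= 4 / Num.sqrt a%:R :> R.
Proof.
(* The term [k = 0] vanishes because the inverse of 0 is 0. *)
move=> a0; rewrite big_nat_recl//= sqrtr0 mulr0 invr0 add0r.
set s := Num.sqrt a%:R.
have s0 : 0 < s by rewrite sqrtr_gt0 ltr0n.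
have s2 : s ^+ 2 = a%:R by rewrite sqr_sqrtr.
apply: (@le_trans _ _ (4 / s - 4 / (s + Num.sqrt B%:R))); last first.
  by rewrite gerBl divr_ge0// addr_ge0// ?sqrtr_ge0// ltW.
elim: B => [|B IH]; first by rewrite big_nil sqrtr0 addr0 subrr.
rewrite big_nat_recr//=.
apply: (le_trans (lerD IH (lexx _))).
set u := Num.sqrt B%:R; set v := Num.sqrt B.+1%:R.
have u0 : 0 <= u by rewrite sqrtr_ge0.
have v0 : 0 < v by rewrite sqrtr_gt0 ltr0n.
have u2 : u ^+ 2 = B%:R by rewrite sqr_sqrtr.
have v2 : v ^+ 2 = B%:R + 1 by rewrite sqr_sqrtr// natr1.
have uv : u <= v by rewrite ler_sqrt// ler_nat.
have -> : 4 / s - 4 / (s + v) =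
    4 / s - 4 / (s + u) + 4 / ((v + u) * ((s + u) * (s + v))).
  have E : (v - u) * (v + u) = 1 by rewrite -subr_sqr v2 u2; ring.
  rewrite -[X in X / (_ * (_ * _))]mulr1 -E; field.
  by rewrite !gt_eqF//; lra.
rewrite lerD2l addnS -natr1 natrD -addrA -v2 -s2 -[leLHS]mul1r.
rewrite ler_pdivrMr ?mulr_gt0 ?addr_gt0 ?exprn_gt0// mulrAC.
rewrite ler_pdivlMr; last by rewrite !mulr_gt0//; lra.
rewrite mul1r.
have h1 : (s + u) * (s + v) <= (s + v) ^+ 2 by rewrite expr2 ler_pM2r ?addr_gt0//; lra.
have h2 : (s + v) ^+ 2 <= 2 * (s ^+ 2 + v ^+ 2).
  rewrite -subr_ge0 (_ : _ - _ = (s - v) ^+ 2) ?sqr_ge0//; ring.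
have h3 : v + u <= 2 * v by lra.
have h4 : (v + u) * ((s + u) * (s + v)) <= 2 * v * (2 * (s ^+ 2 + v ^+ 2)).
  by apply: ler_pM; rewrite ?mulr_ge0//; try lra; exact: le_trans h1 h2.
lra.
Qed.

Lemma spectral_norm_le (R : realType) (m n : nat) (A : 'M[R]_(m, n)) (c : R) :
  0 <= c ->
  (forall x : 'cV[R]_n, \sum_i (A *m x) i 0 ^+ 2 <= c ^+ 2 * \sum_j x j 0 ^+ 2) ->
  spectral_norm A <= c.
Proof.
move=> c0 H; apply: ge_sup.
  exists (enorm (A *m (0 : 'cV_n))), 0 => //=.
  by rewrite /enorm big1 ?sqrtr0 ?ler01// => i _; rewrite mxE expr0n.
move=> _ [x /= x1 <-]; rewrite /enorm.
apply: (le_trans (ler_wsqrtr (H x))).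
rewrite sqrtrM ?sqr_ge0// sqrtr_sqr ger0_norm// -[leRHS]mulr1 ler_wpM2l//.
Qed.

Lemma spectral_norm_ge (R : realType) (m n : nat) (A : 'M[R]_(m, n)) (x : 'cV_n) :
  enorm x <= 1 -> enorm (A *m x) <= spectral_norm A.
Proof.
move=> x1; apply: ub_le_sup; last by exists x.
(* Any upper bound serves to make the supremum meaningful; this one uses only that each [y j 0 ^+ 2]
   is at most 1. *)
exists (Num.sqrt (\sum_i n%:R * \sum_j A i j ^+ 2)) => _ [y /= y1 <-].
apply: ler_wsqrtr; apply: ler_sum => i _; rewrite mxE.
have := @weighted_cauchy_schwarz R n (fun=> 1) (fun j => A i j * y j 0) (fun=> ler01).
rewrite /= sumr_const card_ord; under eq_bigr do rewrite mul1r.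
move=> /le_trans; apply; rewrite ler_wpM2l//; apply: ler_sum => j _.
rewrite mul1r exprMn -[leRHS]mulr1 ler_wpM2l ?sqr_ge0//.
have : \sum_k y k 0 ^+ 2 <= 1.
  have := lerXn2r 2 _ _ y1; rewrite !nnegrE sqrtr_ge0 ler01 expr1n => /(_ isT isT).
  by rewrite sqr_sqrtr// sumr_ge0// => k _; rewrite sqr_ge0.
by apply: le_trans; rewrite (bigD1 j)//= lerDl sumr_ge0// => k _; rewrite sqr_ge0.
Qed.

(** Zero on the row and the column of index 0, where the approximation will be exact and the weight
    [1 / sqrt a] degenerates. *)
Definition hilbert_kernel (R : realType) (a b : nat) : R :=
  if (a == 0)%N || (b == 0)%N then 0 else (a + b)%:R^-1.

Lemma hilbert_kernelC (R : realType) (a b : nat) :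
  hilbert_kernel R a b = hilbert_kernel R b a.
Proof. by rewrite /hilbert_kernel orbC addnC. Qed.

Lemma hilbert_kernel_ge0 (R : realType) (a b : nat) : 0 <= hilbert_kernel R a b.
Proof. by rewrite /hilbert_kernel; case: ifP; rewrite ?invr_ge0. Qed.

Lemma hilbert_kernel_sum_le (R : realType) (n a : nat) (b : 'I_n -> nat) :
  injective b ->
  \sum_j hilbert_kernel R a (b j) / Num.sqrt (b j)%:R <= 4 / Num.sqrt a%:R.
Proof.
move=> b_inj; have [->|a0] := posnP a.
  by rewrite big1 ?divr_ge0 ?sqrtr_ge0// => j _; rewrite /hilbert_kernel mul0r.
pose B := \max_j b j.
apply: le_trans (hilbert_sum_le R a B a0).
apply: le_trans (@sum_inj_le R n B.+1 b _ b_inj _ _); last 2 first.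
- by move=> j; rewrite ltnS leq_bigmax.
- by move=> k; rewrite invr_ge0 mulr_ge0 ?sqrtr_ge0.
apply: ler_sum => j _; rewrite /hilbert_kernel gtn_eqF//= invfM.
by case: eqP => [->|//]; rewrite sqrtr0 invr0 !mulr0.
Qed.

(* Schur's test with the weights [a |-> 1 / sqrt a]. *)
Lemma spectral_norm_hilbert (R : realType) (m n : nat) (D : 'M[R]_(m, n))
    (a : 'I_m -> nat) (b : 'I_n -> nat) (d : R) :
  injective a -> injective b -> 0 <= d ->
  (forall i j, `|D i j| <= d * hilbert_kernel R (a i) (b j)) ->
  spectral_norm D <= 4 * d.
Proof.
move=> a_inj b_inj d0 HD; apply: spectral_norm_le; first by rewrite mulr_ge0.
move=> x.
pose K i j := hilbert_kernel R (a i) (b j); pose w k : R := Num.sqrt k%:R.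
have K0 i j : 0 <= K i j by exact: hilbert_kernel_ge0.
have w0 k : 0 <= w k by exact: sqrtr_ge0.
(* Where the weight [w (b j)] vanishes, so does [K i j], hence no case is lost in the division. *)
have Kw i j y : K i j * y = K i j / w (b j) * (w (b j) * y).
  rewrite mulrA /K /hilbert_kernel; case: ifP => [|/norP[_ bj0]].
    by rewrite !mul0r.
  by rewrite divfK// sqrtr_eq0 -ltNge ltr0n lt0n.
(* Cauchy-Schwarz with the weights [K i j / w (b j)] gives one factor 4 from the row sums; the
   column sums give the other below. *)
apply: (@le_trans _ _ (\sum_i d ^+ 2 *
    (4 / w (a i) * \sum_j K i j * (w (b j) * x j 0 ^+ 2)))).
  apply: ler_sum => i _.
  apply: (@le_trans _ _ (d ^+ 2 * (\sum_j K i j * `|x j 0|) ^+ 2)).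
    rewrite -exprMn -[leLHS]real_normK ?num_real// lerXn2r ?nnegrE//.
      by rewrite mulr_ge0// sumr_ge0// => j _; rewrite mulr_ge0.
    rewrite mxE mulr_sumr; apply: (le_trans (ler_norm_sum _ _ _)).
    by apply: ler_sum => j _; rewrite normrM mulrA ler_wpM2r.
  rewrite ler_wpM2l ?sqr_ge0//.
  under eq_bigr do rewrite Kw.
  apply: (le_trans (@weighted_cauchy_schwarz R n _ _ _)).
    by move=> j; rewrite divr_ge0.
  apply: ler_pM.
  - by apply: sumr_ge0 => j _; rewrite divr_ge0.
  - by apply: sumr_ge0 => j _; rewrite mulr_ge0 ?sqr_ge0// divr_ge0.
  - exact: hilbert_kernel_sum_le.
  apply: ler_sum => j _; rewrite exprMn real_normK ?num_real//.
  by rewrite [leRHS]Kw expr2 !mulrA.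
rewrite -mulr_sumr exprMn (mulrC (4 ^+ 2)) -[leRHS]mulrA ler_wpM2l ?sqr_ge0//.
under eq_bigr do rewrite mulr_sumr.
rewrite exchange_big/= mulr_sumr; apply: ler_sum => j _.
rewrite (eq_bigr (fun i => (4 * (w (b j) * x j 0 ^+ 2)) * (K i j / w (a i)))); last first.
  by move=> i _; ring.
rewrite -mulr_sumr.
have H := @hilbert_kernel_sum_le R m (b j) a a_inj.
rewrite (eq_bigr (fun i => hilbert_kernel R (b j) (a i) / Num.sqrt (a i)%:R)); last first.
  by move=> i _; rewrite /K hilbert_kernelC.
apply: (le_trans (ler_wpM2l _ H)); first by rewrite mulr_ge0// mulr_ge0// sqr_ge0.
rewrite -/(w (b j)).
have [->|wb] := eqVneq (w (b j)) 0.
  by rewrite !(mul0r, mulr0) mulr_ge0// sqr_ge0.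
have -> : 4 * (w (b j) * x j 0 ^+ 2) * (4 / w (b j)) = 4 ^+ 2 * x j 0 ^+ 2.
  by field.
by [].
Qed.

(** * Separable approximation of the coefficients and of matrices built from them *)

Lemma gbinom_separable_approx (R : realType) (alpha eps : R) (N L : nat) :
  1 < alpha -> alpha < 2 -> (10 <= N)%N -> 0 < eps -> eps < 1 ->
  2 * (2 / pi ^+ 2 * ln (4 / pi * N%:R) * ln (32 / eps)) <= L%:R ->
  exists phi psi : nat -> nat -> R, forall a b,
    (0 < a)%N -> (0 < b)%N -> (2 * a.+1 <= N)%N -> (a + b <= N)%N ->
    `|gbinom alpha (a + b + 2) - \sum_(0 <= l < L) phi l a * psi l b| <=
    eps * alpha / 4 / (a + b)%:R.
Proof.
move=> al1 al2 N10 eps0 eps1 HL.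
have [xi xi0 Hxi] := exists_blaschke_nodes R N L eps N10 eps0 eps1 HL.
have [f [g fg]] := blaschke_separable R xi L xi0.
have N0 : 0 < N%:R :> R by rewrite ltr0n (leq_trans _ N10).
(* So many partial fractions that the truncation error [n%:R^-1] is at most [eps / 8 / (a + b)]. *)
have [n n2 Hn] : exists2 n, (2 <= n)%N & 8 * N%:R / eps <= n%:R.
  have h0 : 0 <= 8 * N%:R / eps by rewrite divr_ge0 ?mulr_ge0// ltW.
  exists (Num.truncn (8 * N%:R / eps)).+2 => //.
  by rewrite (le_trans (ltW (truncnS_gt _)))// ler_nat.
have [c /andP[c0 c38] Hc] := gbinom_pfrac R alpha n al1 al2 n2.
(* All poles share the functions [f l] of [x], so the sum over [m] goes into the second factor and
   [L] terms suffice for every [n]. *)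
exists (fun l a => f l a.+1%:R),
  (fun l b => c * \sum_(0 <= m < n) gbinom alpha m * g l (b.+1%:R - alpha + m%:R)).
move=> a b a0 b0 aN abN.
have aR : 1 <= a%:R :> R by rewrite (ler_nat _ 1).
have bR : 1 <= b%:R :> R by rewrite (ler_nat _ 1).
have x2 : 2 <= a.+1%:R :> R by rewrite (ler_nat _ 2).
pose y m : R := b.+1%:R - alpha + m%:R.
(* Here [b >= 1] matters: it gives [b + 1 >= 2 > alpha]. *)
have y0 m : 0 < y m.
  by rewrite /y -natr1; have := ler0n R m; lra.
have xy m : a.+1%:R + y m = (a + b + 2)%:R - alpha + m%:R.
  by rewrite /y -!natr1 !natrD; ring.
set B := blaschke R xi L.
pose s m := gbinom alpha m * (B (y m) / (a.+1%:R + y m)).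
have -> : \sum_(0 <= l < L) f l a.+1%:R *
      (c * \sum_(0 <= m < n) gbinom alpha m * g l (b.+1%:R - alpha + m%:R))
    = c * pfrac R alpha n (a + b + 2) - c * (B a.+1%:R * \sum_(0 <= m < n) s m).
  rewrite -mulrBr /pfrac (mulr_sumr _ _ _ (B _)) -sumrB.
  under eq_bigr do rewrite mulrCA; rewrite -mulr_sumr; congr (_ * _).
  under eq_bigr do rewrite mulr_sumr; rewrite exchange_big/=.
  apply: eq_bigr => m _.
  rewrite -xy /s; transitivity (gbinom alpha m *
      ((1 - B a.+1%:R * B (y m)) / (a.+1%:R + y m))); last by ring.
  rewrite fg//.
  by rewrite mulr_sumr; apply: eq_bigr => l _; rewrite mulrCA.
rewrite opprB addrCA.
have ab0 : 0 < (a + b)%:R :> R by rewrite ltr0n addn_gt0 a0.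
have Bx : `|B a.+1%:R| <= eps / 32.
  by apply: Hxi => //; rewrite -natrM ler_nat.
have Hs : `|\sum_(0 <= m < n) s m| <= 2 * alpha / (a + b)%:R.
  apply: (le_trans (ler_norm_sum _ _ _)).
  apply: (@le_trans _ _ (\sum_(0 <= m < n) `|gbinom alpha m| / (a + b)%:R)).
    apply: ler_sum => m _; rewrite /s normrM ler_wpM2l// normrM.
    have xy0 : 0 < a.+1%:R + y m by rewrite addr_gt0.
    rewrite normfV (gtr0_norm xy0) -[leRHS]mul1r ler_pM ?invr_ge0 ?(ltW xy0)//.
      exact: norm_blaschke_le1.
    rewrite lef_pV2 ?posrE// xy (natrD _ (a + b)) -!addrA lerDl.
    by have := ler0n R m; lra.
  rewrite -mulr_suml ler_wpM2r ?invr_ge0 ?(ltW ab0)//.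
  exact: sum_norm_gbinom.
have Hn' : n%:R^-1 <= eps / 8 / (a + b)%:R.
  have -> : eps / 8 / (a + b)%:R = (8 * (a + b)%:R / eps)^-1.
    by rewrite invf_div invfM mulrA.
  have e0 : 0 < 8 * (a + b)%:R / eps by rewrite divr_gt0 ?mulr_gt0.
  have le8 : 8 * (a + b)%:R / eps <= 8 * N%:R / eps.
    by rewrite ler_pM2r ?invr_gt0// ler_pM2l// ler_nat.
  rewrite lef_pV2 ?posrE//; first exact: le_trans le8 Hn.
  by rewrite ltr0n (leq_trans _ n2).
have Hck := Hc (a + b + 2)%N (leq_addl _ _).
have HcB : `|c * (B a.+1%:R * \sum_(0 <= m < n) s m)| <=
    3 / 8 * (eps / 32 * (2 * alpha / (a + b)%:R)).
  rewrite normrM (ger0_norm c0) normrM ler_pM// ?mulr_ge0//.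
  by rewrite ler_pM.
(* The errors are [3 / 128 * eps * alpha] from the Blaschke product and [eps / 8] from the
   truncation, both over [a + b]; [alpha > 1] absorbs the second. *)
apply: (le_trans (ler_normD _ _)).
apply: (le_trans (lerD HcB (le_trans Hck Hn'))).
have : 0 < (a + b)%:R^-1 :> R by rewrite invr_gt0.
move: (a + b)%:R^-1 => v v0.
have u0 : 0 < eps * v by rewrite mulr_gt0.
have u1 : 0 <= eps * v * (alpha - 1) by rewrite mulr_ge0//; lra.
lra.
Qed.

Lemma min_rank_of_entries (R : realType) (m n L : nat) (Y : 'M[R]_(m, n))
    (a : 'I_m -> nat) (b : 'I_n -> nat) (h : nat -> nat -> R)
    (phi psi : nat -> nat -> R) (d e : R) :
  injective a -> injective b -> (forall i j, Y i j = h (a i) (b j)) ->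
  0 <= d -> 4 * d <= e ->
  (forall i j, (0 < a i)%N -> (0 < b j)%N ->
    `|h (a i) (b j) - \sum_(0 <= l < L) phi l (a i) * psi l (b j)| <=
    d / (a i + b j)%:R) ->
  (min_rank e Y <= 2 + L)%N.
Proof.
move=> a_inj b_inj HY d0 de H.
(* [Z1] is the row [a = 0], [Z2] the column [b = 0] without their common entry, and [Z3] the
   separable approximation elsewhere. *)
pose Z1 : 'M[R]_(m, n) :=
  (\col_i (if a i == 0%N then 1 else 0)) *m (\row_j h 0%N (b j)).
pose Z2 : 'M[R]_(m, n) :=
  (\col_i (if a i == 0%N then 0 else h (a i) 0%N)) *m
  (\row_j (if b j == 0%N then 1 else 0)).
pose Z3 : 'M[R]_(m, n) :=
  (\matrix_(i < m, l < L) (if a i == 0%N then 0 else phi l (a i))) *m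
  (\matrix_(l < L, j < n) (if b j == 0%N then 0 else psi l (b j))).
pose Z := Z1 + (Z2 + Z3).
have rZ : (\rank Z <= 2 + L)%N.
  apply: (leq_trans (mxrank_add _ _)).
  rewrite -[(2 + L)%N]/(1 + (1 + L))%N leq_add ?mulmx_max_rank//.
  apply: (leq_trans (mxrank_add _ _)).
  by rewrite leq_add ?mulmx_max_rank.
have ZE i j : Z i j = if (a i == 0)%N || (b j == 0)%N then h (a i) (b j)
    else \sum_(0 <= l < L) phi l (a i) * psi l (b j).
  rewrite !mxE !big_ord1 !mxE.
  have [ai0|ai0]/= := eqVneq (a i) 0%N.
    rewrite mul1r mul0r add0r ai0 big1 ?addr0// => l _.
    by rewrite !mxE ai0 mul0r.
  have [bj0|bj0]/= := eqVneq (b j) 0%N.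
    rewrite mul0r add0r mulr1 bj0 big1 ?addr0// => l _.
    by rewrite !mxE bj0 mulr0.
  rewrite mul0r add0r mulr0 add0r big_mkord; apply: eq_bigr => l _.
  by rewrite !mxE (negbTE ai0) (negbTE bj0).
suff /(min_rank_le Y) : spectral_norm (Z - Y) <= e.
  by rewrite addrC subrK => /leq_trans; exact.
apply: le_trans de.
apply: (spectral_norm_hilbert R m n _ a b d a_inj b_inj d0) => i j.
rewrite mxE ZE mxE HY /hilbert_kernel; case: ifP => [_|/norP[ai0 bj0]].
  by rewrite subrr normr0 mulr0.
by rewrite distrC H// lt0n.
Qed.

(** * The blocks of the Toeplitz matrix *)

Lemma spectral_norm_Tmx_ge (R : realType) (alpha : R) (N : nat) :
  0 <= alpha -> (1 <= N)%N -> alpha <= spectral_norm (Tmx alpha N).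
Proof.
move=> al0; case: N => // N _.
(* The first unit vector selects the first column, whose top entry is [- gbinom alpha 1 = alpha]. *)
have enorm1 : enorm (delta_mx 0 0 : 'cV[R]_N.+1) <= 1.
  rewrite /enorm (bigD1 ord0)//= mxE eqxx expr1n big1 ?addr0 ?sqrtr1//.
  by move=> i /negbTE i0; rewrite mxE i0 expr0n.
apply: le_trans (spectral_norm_ge _ _ _ _ _ enorm1).
rewrite -[leLHS]ger0_norm// -sqrtr_sqr /enorm; apply: ler_wsqrtr.
rewrite (bigD1 ord0)//= -colE !mxE/= gbinom1 opprK lerDl.
by rewrite sumr_ge0// => i _; rewrite sqr_ge0.
Qed.

(** The sign is there because [- Y] is the perturbation that removes a block [Y] entirely. *)
Lemma spectral_norm_submatrix (R : realType) (n : nat) (X : 'M[R]_n)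
    (I J : {set 'I_n}) :
  spectral_norm (- submatrix X I J) <= spectral_norm X.
Proof.
have sum_val (K : {set 'I_n}) (F : 'I_n -> R) :
    \sum_(i < #|K|) F (enum_val i) = \sum_(i in K) F i.
  by rewrite [RHS]big_enum_val.
apply: ge_sup.
  exists (enorm (- submatrix X I J *m (0 : 'cV_ _))), 0 => //=.
  by rewrite /enorm big1 ?sqrtr0 ?ler01// => i _; rewrite mxE expr0n.
move=> _ [x /= x1 <-].
(* The extension of [x] by zero outside [J]. *)
pose x' : 'cV[R]_n := \col_k \sum_(j < #|J|) (enum_val j == k)%:R * x j 0.
have x'val j : x' (enum_val j) 0 = x j 0.
  rewrite mxE (bigD1 j)//= eqxx mul1r big1 ?addr0// => l lj.
  by rewrite (inj_eq enum_val_inj) (negbTE lj) mul0r.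
have x'0 k : k \notin J -> x' k 0 = 0.
  move=> kJ; rewrite mxE big1// => l _; case: eqP => [lk|_]; last by rewrite mul0r.
  by move: kJ; rewrite -lk enum_valP.
have sumJ (F : 'I_n -> R) : (forall k, k \notin J -> F k = 0) ->
    \sum_k F k = \sum_(j < #|J|) F (enum_val j).
  move=> F0; rewrite sum_val (bigID (mem J))/= [X in _ + X]big1 ?addr0//.
have x'1 : enorm x' <= 1.
  apply: le_trans x1; rewrite /enorm sumJ => [|k kJ]; last by rewrite x'0// expr0n.
  by under eq_bigr do rewrite x'val.
apply: le_trans (spectral_norm_ge _ _ _ _ _ x'1).
apply: ler_wsqrtr.
apply: (@le_trans _ _ (\sum_(i < #|I|) (X *m x') (enum_val i) 0 ^+ 2)).
  apply: ler_sum => i _; rewrite mulNmx [in leLHS]mxE sqrrN le_eqVlt; apply/orP; left.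
  apply/eqP; congr (_ ^+ 2); rewrite !mxE [RHS]sumJ => [|k kJ]; last by rewrite x'0// mulr0.
  by apply: eq_bigr => j _; rewrite x'val mxE.
rewrite (sum_val I (fun k => (X *m x') k 0 ^+ 2)) [leRHS](bigID (mem I))/= lerDl sumr_ge0// => k _; exact: sqr_ge0.
Qed.

Lemma min_rank_upper_block (R : realType) (alpha d : R) (N : nat)
    (I J : {set 'I_N}) : 0 <= d ->
  [forall i in I, forall j in J, (i < j)%N] ->
  (min_rank d (submatrix (Tmx alpha N) I J) <= 1)%N.
Proof.
move=> d0 /forall_inP IJ; set Y := submatrix _ _ _.
have nIJ i j : i \in I -> j \in J -> (i < j)%N by move=> /IJ/forall_inP; exact.
have /leq_trans -> // : (min_rank d Y <= \rank Y)%N.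
  by rewrite -{2}[Y]addr0; apply: min_rank_le; rewrite spectral_norm0.
pose h := \max_(i in I) (i : nat).
(* All columns exceed the last row index [h], so a row [i < h] has [j > i + 1] throughout and is
   zero; only row [h] remains. *)
pose v (j : nat) : R := if (j <= h.+1)%N then - gbinom alpha (h.+1 - j) else 0.
have -> : Y = (\col_i (if @enum_val _ (mem I) i == h :> nat then 1 else 0)) *m
    (\row_j v (@enum_val _ (mem J) j)).
  apply/matrixP => i j; rewrite !mxE big_ord1 !mxE.
  case: eqP => [->|ih]; first by rewrite mul1r.
  have ih' : (enum_val i < h)%N.
    by rewrite ltn_neqAle; apply/andP; split; [exact/eqP|exact/leq_bigmax_cond/enum_valP].
  have hj : (h < enum_val j)%N.
    have [k kI ->] : {k | k \in I & h = k :> nat}.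
      by apply: eq_bigmax_cond; rewrite (cardD1 (enum_val i)) enum_valP.
    by apply: nIJ => //; exact: enum_valP.
  rewrite mul0r ifF//; apply/negbTE; rewrite -ltnNge; exact: leq_ltn_trans ih' hj.
exact: mulmx_max_rank.
Qed.

Lemma min_rank_lower_block (R : realType) (alpha eps : R) (N L : nat)
    (I J : {set 'I_N}) :
  1 < alpha -> alpha < 2 -> 0 < eps -> eps < 1 -> (2 <= L)%N ->
  2 * (2 / pi ^+ 2 * ln (4 / pi * N%:R) * ln (32 / eps)) <= L%:R ->
  [forall i in I, forall j in J, (j < i)%N] -> (0 < #|J|)%N ->
  (min_rank (eps * spectral_norm (Tmx alpha N)) (submatrix (Tmx alpha N) I J)
     <= 2 + L)%N.
Proof.
move=> al1 al2 eps0 eps1 L2 HL /forall_inP IJ J0.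
set e := eps * _; set Y := submatrix _ _ _.
have nIJ i j : i \in I -> j \in J -> (j < i)%N by move=> /IJ/forall_inP; exact.
pose h := \max_(j in J) (j : nat).
have [k kJ hk] : {k | k \in J & h = k :> nat} by exact: eq_bigmax_cond.
have hN : (h < N)%N by rewrite hk.
have Jh (j : 'I_#|J|) : (@enum_val _ (mem J) j <= h)%N by exact/leq_bigmax_cond/enum_valP.
have Ih (i : 'I_#|I|) : (h < @enum_val _ (mem I) i)%N by rewrite hk nIJ// enum_valP.
(* Distances to the corner [(h + 1, h)] of the largest block with last column [h]; thus
   [i - j + 1 = a + b + 2]. *)
pose a (i : 'I_#|I|) := (@enum_val _ (mem I) i - h.+1)%N.
pose b (j : 'I_#|J|) := (h - @enum_val _ (mem J) j)%N.
have a_inj : injective a.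
  move=> i i' ii'.
  have E : @enum_val _ (mem I) i = @enum_val _ (mem I) i' :> nat.
    by have := Ih i; have := Ih i'; move: ii'; rewrite /a; lia.
  exact/enum_val_inj/val_inj/E.
have b_inj : injective b.
  move=> j j' jj'.
  have E : @enum_val _ (mem J) j = @enum_val _ (mem J) j' :> nat.
    by have := Jh j; have := Jh j'; move: jj'; rewrite /b; lia.
  exact/enum_val_inj/val_inj/E.
have ap i : (a i < N - h.+1)%N.
  by rewrite /a; have := Ih i; have := ltn_ord (@enum_val _ (mem I) i); lia.
have bq j : (b j < h.+1)%N by rewrite /b; lia.
have abN i j : (a i + b j <= N)%N by have := ap i; have := bq j; lia.
have N1 : (1 <= N)%N by lia.
have e0 : eps * alpha <= e by rewrite ler_pM2l// spectral_norm_Tmx_ge//; lra.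
have ea0 : 0 < eps * alpha by rewrite mulr_gt0//; lra.
have YE i j : Y i j = - gbinom alpha (a i + b j + 2).
  rewrite !mxE ifT; last by have := Ih i; have := Jh j; lia.
  congr (- gbinom _ _); rewrite /a /b; have := Ih i; have := Jh j; lia.
(* A block with at most 4 rows or columns has rank at most [4 <= 2 + L]; otherwise both sides are at
   least 5, whence [N >= 10]. *)
have [small|big] := leqP (minn (N - h.+1) h.+1) 4.
  apply: (@leq_trans (\rank Y)).
    rewrite -{2}[Y]addr0; apply: min_rank_le; rewrite spectral_norm0; lra.
  have cI : (#|I| <= N - h.+1)%N.
    have := leq_card (fun i => Ordinal (ap i)) _; rewrite !card_ord; apply.
    by move=> i i' [] /a_inj.
  have cJ : (#|J| <= h.+1)%N.
    have := leq_card (fun j => Ordinal (bq j)) _; rewrite !card_ord; apply.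
    by move=> j j' [] /b_inj.
  have := rank_leq_row Y; have := rank_leq_col Y; lia.
have N10 : (10 <= N)%N by lia.
have [phi [psi Happ]] :=
  gbinom_separable_approx R alpha eps N L al1 al2 N10 eps0 eps1 HL.
have d0 : 0 <= eps * alpha / 4 by lra.
(* The factor 4 of Hilbert's inequality cancels, and [alpha] is at most the norm of the whole
   matrix. *)
have de : 4 * (eps * alpha / 4) <= e by lra.
(* The index along the shorter side takes the role of [x], so that [2 * x <= N]. *)
have [pq|qp] := leqP (N - h.+1) h.+1.
  apply: (min_rank_of_entries R _ _ L Y a b (fun x y => - gbinom alpha (x + y + 2))
    (fun l x => - phi l x) psi _ _ a_inj b_inj YE d0 de) => i j ai bj.
  under eq_bigr do rewrite mulNr.
  rewrite sumrN -opprD normrN Happ//; have := ap i; lia.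
apply: (min_rank_of_entries R _ _ L Y a b (fun x y => - gbinom alpha (x + y + 2))
  (fun l x => - psi l x) phi _ _ a_inj b_inj YE d0 de) => i j ai bj.
under eq_bigr do rewrite mulNr mulrC.
rewrite sumrN -opprD normrN (addnC (a i)) Happ//; have := bq j; have := abN i j; lia.
Qed.

Theorem lemma3p15 (R : realType) (alpha : R) (N : nat) (eps : R)
    (halpha1 : 1 < alpha) (halpha2 : alpha < 2) (hN : (1 <= N)%N)
    (heps : 0 < eps) :
  (Posz (qsrank eps (Tmx alpha N)) <= Num.max 0 (Bfrak N (eps / 2)))
  /\ Bfrak N (eps / 2) =
     2 + 2 * Num.ceil (2 / pi ^+ 2 * ln (4 / pi * N%:R) * ln (32 / eps) : R).
Proof.
have BE : Bfrak N (eps / 2) =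
    2 + 2 * Num.ceil (2 / pi ^+ 2 * ln (4 / pi * N%:R) * ln (32 / eps) : R).
  rewrite /Bfrak (_ : 16 / (eps / 2) = 32 / eps)//.
  by field; rewrite gt_eqF.
split=> //.
have T0 : 0 <= spectral_norm (Tmx alpha N).
  by apply: le_trans (spectral_norm_Tmx_ge R alpha N _ hN); lra.
(* For [eps >= 1] the perturbation [- Y] is admissible, so every block has minimal rank 0. *)
have [eps1|eps1] := leP 1 eps.
  rewrite (_ : qsrank _ _ = 0%N) ?le_max ?lexx//.
  apply/eqP; rewrite -leqn0; apply/bigmax_leqP => -[I J] _ /=.
  set Y := submatrix _ _ _.
  rewrite -[X in (_ <= X)%N](mxrank0 R #|I| #|J|) -[X in \rank X](subrr Y).
  apply: min_rank_le; apply: (le_trans (spectral_norm_submatrix _ _ _ _ _)).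
  by rewrite ler_peMl.
rewrite BE le_max; apply/orP; right.
set x := _ * ln (32 / eps).
have NR : 1 <= N%:R :> R by rewrite (ler_nat _ 1).
have p2 := pi_ge2 R; have p16 := pi_le_16_5 R.
have x0 : 0 < x.
  rewrite mulr_gt0// ?mulr_gt0 ?invr_gt0 ?exprn_gt0//; first lra.
  - apply: ln_gt0; rewrite mulrAC ltr_pdivlMr; lra.
  - apply: ln_gt0; rewrite ltr_pdivlMr; lra.
(* Positivity makes the ceiling a natural number [K >= 1]; the number of nodes is then
   [L = 2 * K >= 2]. *)
have : 0 < Num.ceil x by rewrite ceil_gt0.
have := ceil_ge x.
case: (Num.ceil x) => // K xK K0.
suff H : (qsrank eps (Tmx alpha N) <= 2 + 2 * K)%N.
  by rewrite -PoszM -PoszD lez_nat.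
apply/bigmax_leqP => -[I J] /=; rewrite /off_diagonal /= => /and3P[_ J0 /orP[lo|up]].
  apply: min_rank_lower_block => //; first by lia.
  by rewrite -/x natrM ler_pM2l.
apply: leq_trans (min_rank_upper_block _ _ _ _ _ _ _ up) _ => //.
by rewrite mulr_ge0// ltW.
Qed.
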